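(* Let $k\ge 3$ and let $\tau\in\mathcal{S}_k$ satisfy $\tau(k-1)=k-1$ and $\tau(k)=k$. Define $\widetilde\tau\in\mathcal{S}_k$ by $\widetilde\tau(i)=\tau(i)$ for $1\le i\le k-2$, $\widetilde\tau(k-1)=k$ and $\widetilde\tau(k)=k-1$. Then for every fixed (unlabeled) rooted forest with $n$ vertices there is a bijection between the labelings of it (bijective labelings of its vertices by $[n]=\{1,\dots,n\}$) that avoid $\tau$ and the labelings that avoid $\widetilde\tau$. Consequently $\tau$ and $\widetilde\tau$ are forest-structure-Wilf equivalent, and hence forest-Wilf equivalent.
   Context: Forests are unordered (non-planar) rooted forests; a forest on $[n]$ is such a forest with $n$ vertices labeled bijectively by $1,\dots,n$. For a pattern $\sigma\in\mathcal{S}_k$, an instance of $\sigma$ in a labeled forest is a sequence of vertices $v_1,\dots,v_k$ such that $v_i$ is a strict ancestor of $v_j$ whenever $i<j$ (ancestors lie on the path from the root of the tree to the vertex) and the labels of $v_1,\dots,v_k$ are in the same relative order as $\sigma(1),\dots,\sigma(k)$. The forest avoids $\sigma$ if it has no instance of $\sigma$; it avoids a set $S$ of patterns if it avoids each member. Let $f_n(S)$ be the number of forests on $[n]$ avoiding $S$. Two sets of patterns $S,S'$ are forest-Wilf equivalent if $f_n(S)=f_n(S')$ for all $n$, and forest-structure-Wilf equivalent if for every fixed unlabeled rooted forest, the number of its labelings (by $[n]$, $n$ its number of vertices) avoiding $S$ equals the number avoiding $S'$. *)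

(* Defs.v *)
From HB Require Import structures.
From mathcomp Require Import all_boot all_fingroup.
From mathcomp Require Import boolp classical_sets.

Set Implicit Arguments.
Unset Strict Implicit.
Unset Printing Implicit Defensive.

(* The set [n] = {1, ..., n} is represented by 'I_n = {0, ..., n-1}: every
   label, position and value is shifted down by one. *)

(* A rooted forest on the vertex set V is given by the partial function sending
   each vertex to its parent; roots are sent to None. *)
Definition is_parent (V : finType) (p : {ffun V -> option V}) : rel V :=
  fun v u => p v == Some u.

Definition strict_anc (V : finType) (p : {ffun V -> option V}) (u v : V) : bool :=
  [exists w, is_parent p v w && connect (is_parent p) w u].

(* V being finite, a partial function is the parent function of a rooted forest
   exactly when it has no cycle. *)
Definition acyclic (V : finType) (p : {ffun V -> option V}) : bool :=
  [forall v, ~~ strict_anc p v v].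

Record forest (V : finType) : Type :=
  Forest { parent : {ffun V -> option V}; _ : acyclic parent }.
HB.instance Definition _ (V : finType) := [isSub for @parent V].
HB.instance Definition _ (V : finType) := [Finite of forest V by <:].

Record labeling (V : finType) (n : nat) : Type :=
  Labeling { label : {ffun V -> 'I_n}; _ : `[< bijective label >] }.
HB.instance Definition _ (V : finType) (n : nat) := [isSub for @label V n].
HB.instance Definition _ (V : finType) (n : nat) :=
  [Finite of labeling V n by <:].

Definition is_instance (V : finType) (n : nat) (F : forest V) (l : V -> 'I_n)
    (k : nat) (s : 'S_k) (v : {ffun 'I_k -> V}) : bool :=
  [forall i : 'I_k, forall j : 'I_k,
     ((i < j) ==> strict_anc (parent F) (v i) (v j))
     && ((l (v i) < l (v j)) == (s i < s j))].

Definition avoids (V : finType) (n : nat) (F : forest V) (l : V -> 'I_n)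
    (k : nat) (s : 'S_k) : bool :=
  ~~ [exists v : {ffun 'I_k -> V}, is_instance F l s v].

Definition pattern : Type := {k : nat & 'S_k}.

Definition to_pattern (k : nat) (s : 'S_k) : pattern :=
  existT (fun k : nat => 'S_k) k s.

Definition avoids_set (V : finType) (n : nat) (F : forest V) (l : V -> 'I_n)
    (S : set pattern) : Prop :=
  forall s : pattern, S s -> avoids F l (projT2 s).

(* A forest on [n] is a forest whose vertices are their own labels. *)
Definition num_forests (n : nat) (S : set pattern) : nat :=
  #|[pred F : forest 'I_n | `[< avoids_set F (fun v : 'I_n => v) S >]]|.

Definition forest_Wilf_equiv (S S' : set pattern) : Prop :=
  forall n : nat, num_forests n S = num_forests n S'.

(* An unlabeled forest is given by any representative F. Labelings are counted
   as maps on the vertices of F, not up to automorphisms of F. As Aut(F) acts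
   freely on the labelings and preserves avoidance, counting up to automorphism
   divides every count by #|Aut(F)| and gives the same equivalence. *)
Definition num_labelings (V : finType) (n : nat) (F : forest V)
    (S : set pattern) : nat :=
  #|[pred l : labeling V n | `[< avoids_set F (label l) S >]]|.

Definition forest_structure_Wilf_equiv (S S' : set pattern) : Prop :=
  forall (V : finType) (n : nat) (F : forest V), #|V| = n ->
    num_labelings n F S = num_labelings n F S'.

(* Main.v *)
(** Write [tau = rho + 12] and [tau' = rho + 21]. In a labeled forest, say that [v]
    exceeds at height [y] if an occurrence of [rho] with all labels below [y] lies
    strictly above [v]; [v] is marked if it exceeds at the height of its own label.
    Then a labeling avoids [tau] iff every marked vertex carries a larger label than
    all its descendants, and avoids [tau'] iff every marked vertex [v] carries the
    smallest label among those of its subtree at which [v] exceeds.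
    Fix a marked [v] and let [B] be the set of labels of its subtree at which [v]
    exceeds. Rotating [B] (each label to the next larger one, the maximum to the
    minimum) changes neither [B] nor the heights at which vertices exceed; it turns
    labelings where [v] has the maximum of [B] into those where [v] has the minimum;
    and, starting from the former, it affects neither condition at other vertices.
    So the condition for [tau] can be replaced by the one for [tau'] vertex by
    vertex, in any order, without changing the number of labelings.
    Finally, [n! * f_n(S)] is the sum of the numbers of [S]-avoiding labelings over
    all forests on [n], so forest-structure-Wilf equivalence implies forest-Wilf
    equivalence. *)

Require Import Defs.
From mathcomp Require Import all_boot all_fingroup.
From mathcomp Require Import boolp classical_sets.

Set Implicit Arguments.
Unset Strict Implicit.
Unset Printing Implicit Defensive.

(** * Cyclic successor in a finite set of labels *)

Section CyclicShift.

Variables (n : nat) (B : {set 'I_n}).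

Local Notation s := (enum B).

Lemma enum_ord_set_sorted : sorted (fun x y : 'I_n => x < y) s.
Proof.
rewrite /enum_mem -enumT; apply: sorted_filter.
  by move=> x y z; apply: ltn_trans.
by have := iota_ltn_sorted 0 n; rewrite -val_enum_ord sorted_map enumT.
Qed.

Lemma nth_enum_ord_set_ltn z i j :
  i < size s -> j < size s -> (nth z s i < nth z s j) = (i < j).
Proof.
move=> hi hj.
have H a b : b < size s -> a < b -> nth z s a < nth z s b.
  move=> hb hab; apply: (sorted_ltn_nth _ z enum_ord_set_sorted) => //.
    by move=> x y w; apply: ltn_trans.
  by rewrite inE (ltn_trans hab).
case: (ltngtP i j) => [hij|hij|->]; last by rewrite ltnn.
  by rewrite H.
by apply/negbTE; rewrite -leqNgt ltnW // H.
Qed.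

Lemma next_enum_ltn x y : x \in B -> y \in B -> x < y ->
  x < next s x /\ next s x <= y.
Proof.
rewrite -!(mem_enum B) => xs ys xy.
have hx : index x s < size s by rewrite index_mem.
have hy : index y s < size s by rewrite index_mem.
have hxy : index x s < index y s.
  by rewrite -(nth_enum_ord_set_ltn x) // !nth_index.
have -> : next s x = nth x s (index x s).+1.
  rewrite next_nth xs; case: {-1}s hx hy hxy => //= z p hx hy hxy.
  by apply: set_nth_default; rewrite -ltnS; apply: leq_trans hy.
have hx1 : (index x s).+1 < size s by apply: leq_ltn_trans hy.
split.
  by rewrite -{1}(nth_index x xs) nth_enum_ord_set_ltn.
by rewrite leqNgt -{1}(nth_index x ys) nth_enum_ord_set_ltn // -leqNgt.
Qed.

Lemma next_enum_max x y : x \in B -> {in B, forall z : 'I_n, z <= x} ->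
  y \in B -> next s x <= y.
Proof.
rewrite -!(mem_enum B) => xs xmax ys.
have hx : index x s < size s by rewrite index_mem.
have hy : index y s < size s by rewrite index_mem.
have -> : next s x = nth x s 0.
  have : ~~ ((index x s).+1 < size s).
    apply/negP => hx1.
    have: nth x s (index x s).+1 <= x.
      by apply: xmax; rewrite -mem_enum mem_nth.
    by rewrite leqNgt -{1}(nth_index x xs) nth_enum_ord_set_ltn // ltnSn.
  (* Past the last index [next_nth] returns its default value, the head of the list: this is the
     wrap-around. *)
  rewrite next_nth xs -leqNgt; case: {-2}s hx => //= z p hx h.
  by rewrite nth_default.
rewrite leqNgt -{1}(nth_index x ys) nth_enum_ord_set_ltn //.
by apply: leq_ltn_trans hx.
Qed.

End CyclicShift.

(** * Heights, marked vertices and the rotation at a vertex *)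

Section Thresholds.

Variables (V : finType) (n m : nat) (anc : rel V) (rho : 'I_m -> nat).

(** Only comparisons of values of [rho] matter, so the initial values of a pattern serve directly,
    without being repackaged as a permutation. *)
Definition is_occurrence (l : V -> 'I_n) (r : {ffun 'I_m -> V}) : bool :=
  [forall i : 'I_m, forall j : 'I_m,
     ((i < j) ==> anc (r i) (r j)) && ((l (r i) < l (r j)) == (rho i < rho j))].

Definition exceeds (l : V -> 'I_n) (v : V) (y : nat) : bool :=
  [exists r : {ffun 'I_m -> V},
     is_occurrence l r && [forall i, anc (r i) v && (l (r i) < y)]].

Definition marked l v := exceeds l v (l v).

Definition max_at l v :=
  marked l v ==> [forall w, anc v w ==> (l w < l v)].

Definition min_at l v :=
  marked l v ==> [forall w, anc v w && exceeds l v (l w) ==> (l v < l w)].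

(** The set to be rotated. It is empty at an unmarked [v], where [rotate] is then the identity. *)
Definition cycle_set (l : V -> 'I_n) v : {set 'I_n} :=
  [set y : 'I_n | [&& marked l v, exceeds l v y &
               [exists w, ((w == v) || anc v w) && (l w == y)]]].

Definition rotate (l : V -> 'I_n) v : {ffun V -> 'I_n} :=
  [ffun w => next (enum (cycle_set l v)) (l w)].

Hypothesis anc_trans : transitive anc.

Lemma exceeds_leq l v y z : y <= z -> exceeds l v y -> exceeds l v z.
Proof.
move=> yz /existsP[r /andP[occ /forallP h]]; apply/existsP; exists r.
rewrite occ; apply/forallP => i; have /andP[-> lt] := h i.
exact: leq_trans yz.
Qed.

Lemma exceeds_ltn l v y z : exceeds l v y -> ~~ exceeds l v z -> z < y.
Proof.
by move=> hy; apply: contraNltn => yz; apply: exceeds_leq hy.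
Qed.

Lemma exceeds_anc l u v y : anc u v -> exceeds l u y -> exceeds l v y.
Proof.
move=> uv /existsP[r /andP[occ /forallP h]]; apply/existsP; exists r.
rewrite occ; apply/forallP => i; have /andP[ri ->] := h i.
by rewrite (anc_trans ri uv).
Qed.

Lemma is_occurrence_congr (l l' : V -> 'I_n) (r : {ffun 'I_m -> V}) :
    (forall i, l' (r i) = l (r i)) ->
  is_occurrence l' r = is_occurrence l r.
Proof.
by move=> e; apply: eq_forallb => i; apply: eq_forallb => j; rewrite !e.
Qed.

(* A marked vertex of an occurrence is itself preceded by an occurrence with
   smaller labels, so a lowest occurrence has no marked vertex: the unmarked
   labels alone determine [exceeds]. *)
Lemma exceeds_congr (l l' : V -> 'I_n) v y :
    (forall u, ~~ marked l u -> l' u = l u) ->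
    (forall u, marked l u -> exceeds l u (l' u)) ->
  exceeds l' v y = exceeds l v y.
Proof.
move=> eq_unm exc_m; apply/idP/idP.
  move=> /existsP[r /andP[occ /forallP h]].
  have [/existsP[i mi]|/existsPn nm] := boolP [exists i, marked l (r i)].
    have /andP[ri lt] := h i.
    by apply: (exceeds_leq (ltnW lt)); apply: (exceeds_anc ri); apply: exc_m.
  have e i : l' (r i) = l (r i) by apply: eq_unm.
  apply/existsP; exists r; rewrite -(is_occurrence_congr e) occ.
  by apply/forallP => i; rewrite -e.
elim/ltn_ind: y v => y IH v /existsP[r /andP[occ /forallP h]].
have [/existsP[i mi]|/existsPn nm] := boolP [exists i, marked l (r i)].
  have /andP[ri lt] := h i.
  by apply: (exceeds_leq (ltnW lt)); apply: (exceeds_anc ri); apply: IH.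
have e i : l' (r i) = l (r i) by apply: eq_unm.
apply/existsP; exists r; rewrite (is_occurrence_congr e) occ.
by apply/forallP => i; rewrite e.
Qed.

Lemma mem_cycle_set l v w : injective l -> marked l v ->
  (l w \in cycle_set l v) = exceeds l v (l w) && ((w == v) || anc v w).
Proof.
move=> l_inj mv; rewrite inE mv /=; congr (_ && _).
apply/existsP/idP => [[w' /andP[h /eqP/l_inj <-]] //|h].
by exists w; rewrite h eqxx.
Qed.

Lemma cycle_setP l v (y : 'I_n) : reflect
  [/\ marked l v, exceeds l v y & exists2 w, (w == v) || anc v w & l w = y]
  (y \in cycle_set l v).
Proof.
rewrite inE; apply: (iffP and3P) => -[-> -> h]; split=> //.
  by have /existsP[w /andP[hw /eqP <-]] := h; exists w.
by have [w hw <-] := h; apply/existsP; exists w; rewrite hw eqxx.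
Qed.

Lemma rotate_id l v w : l w \notin cycle_set l v -> rotate l v w = l w.
Proof. by rewrite ffunE next_nth mem_enum => /negbTE ->. Qed.

Lemma mem_rotate l v w :
  (rotate l v w \in cycle_set l v) = (l w \in cycle_set l v).
Proof. by rewrite ffunE -mem_enum mem_next mem_enum. Qed.

Lemma rotate_inj l v : injective l -> injective (rotate l v).
Proof.
move=> l_inj x y; rewrite !ffunE => /(can_inj (prev_next (enum_uniq _))).
exact: l_inj.
Qed.

Lemma rotate_onto l v (y : 'I_n) : y \in cycle_set l v ->
  exists2 w, (w == v) || anc v w & rotate l v w = y.
Proof.
move=> yB; have: prev (enum (cycle_set l v)) y \in cycle_set l v.
  by rewrite -mem_enum mem_prev mem_enum.
case/cycle_setP=> _ _ [w hw e]; exists w => //.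
by rewrite ffunE e next_prev ?enum_uniq.
Qed.

(** A label that moves belongs to a marked vertex and stays in the cycle set, at whose elements [v]
    and all its descendants exceed. So [exceeds_congr] applies. *)
Lemma exceeds_rotate l v u y : injective l ->
  exceeds (rotate l v) u y = exceeds l u y.
Proof.
move=> l_inj; apply: exceeds_congr => w.
  move=> nm; apply: rotate_id; apply: contra nm => wB.
  have /cycle_setP[mv _ _] := wB.
  move: wB; rewrite mem_cycle_set // => /andP[ex /orP[/eqP->|vw]] //.
  exact: exceeds_anc vw ex.
move=> mw; have [wB|wB] := boolP (l w \in cycle_set l v); last first.
  by rewrite rotate_id.
have /cycle_setP[mv _ _] := wB.
have /cycle_setP[_ ex _] : rotate l v w \in cycle_set l v by rewrite mem_rotate.
move: wB; rewrite mem_cycle_set // => /andP[_ /orP[/eqP wv|vw]].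
  by rewrite {1}wv.
exact: exceeds_anc vw ex.
Qed.

Lemma exceeds_rotate_label l v w : injective l -> marked l v ->
    (w == v) || anc v w ->
  exceeds l v (rotate l v w) = exceeds l v (l w).
Proof.
move=> l_inj mv hw; have [wB|wB] := boolP (l w \in cycle_set l v); last first.
  by rewrite rotate_id.
have: rotate l v w \in cycle_set l v by rewrite mem_rotate.
by case/cycle_setP: wB => _ -> _ /cycle_setP[].
Qed.

Lemma marked_rotate l v : injective l -> marked (rotate l v) v = marked l v.
Proof.
move=> l_inj; rewrite /marked exceeds_rotate //.
have [mv|nmv] := boolP (marked l v).
  by rewrite exceeds_rotate_label ?eqxx //.
by rewrite rotate_id //; apply: contra nmv => /cycle_setP[].
Qed.

Lemma cycle_set_rotate l v : injective l ->
  cycle_set (rotate l v) v = cycle_set l v.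
Proof.
move=> l_inj; apply/setP => y; apply/cycle_setP/idP; rewrite marked_rotate //.
  case=> mv; rewrite exceeds_rotate // => ex [w hw e].
  have [wB|wB] := boolP (l w \in cycle_set l v).
    by rewrite -e mem_rotate.
  rewrite rotate_id // in e; apply/cycle_setP; split=> //.
  by exists w.
move=> yB; have /cycle_setP[mv ex _] := yB; split=> //.
  by rewrite exceeds_rotate.
exact: rotate_onto.
Qed.

(** The cycle set can be read off the rotated labeling, and [prev] along it undoes the rotation. *)
Lemma rotate_can_inj l l' v : injective l -> injective l' ->
  rotate l v = rotate l' v -> l =1 l'.
Proof.
move=> l_inj l'_inj e w.
have eB: cycle_set l v = cycle_set l' v.
  by rewrite -cycle_set_rotate // e cycle_set_rotate.
have := congr1 (fun f : {ffun V -> 'I_n} => f w) e; rewrite !ffunE eB.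
exact: can_inj (prev_next (enum_uniq _)) _ _.
Qed.

Hypothesis anc_irr : irreflexive anc.

(** The rotation sends the maximum of the cycle set to its minimum. For marked [v], having the
    maximum means being above all descendants: a descendant with a larger label is in the set, as
    [exceeds] is monotone in the height. *)
Lemma min_at_rotate l v : injective l -> min_at (rotate l v) v = max_at l v.
Proof.
move=> l_inj; rewrite /min_at /max_at marked_rotate //.
have [mv /=|//] := boolP (marked l v).
have vB : l v \in cycle_set l v by rewrite mem_cycle_set ?eqxx ?andbT.
have sub_next : rotate l v v = next (enum (cycle_set l v)) (l v).
  by rewrite ffunE.
apply/forallP/forallP => h w; apply/implyP.
  move=> vw; rewrite leqNgt; apply/negP => lt.
  rewrite ltnS leq_eqVlt in lt; case/orP: lt => [/eqP/val_inj/l_inj e|lt].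
    by rewrite e anc_irr in vw.
  have wB : l w \in cycle_set l v.
    rewrite mem_cycle_set // vw orbT andbT.
    exact: exceeds_leq (ltnW lt) mv.
  (* The label of [v] increases, while its old value reappears at a descendant [u] and undercuts the
     new one. *)
  have [lt1 _] := next_enum_ltn vB wB lt.
  have [u hu e] := rotate_onto vB.
  case/orP: hu => [/eqP euv|vu].
    by rewrite euv in e; rewrite -sub_next e ltnn in lt1.
  have := h u; rewrite vu exceeds_rotate // e => /implyP/(_ mv).
  by rewrite sub_next ltnNge (ltnW lt1).
rewrite exceeds_rotate // => /andP[vw].
rewrite exceeds_rotate_label ?vw ?orbT // => ex.
have wB : rotate l v w \in cycle_set l v.
  by rewrite mem_rotate mem_cycle_set // ex vw orbT.
rewrite ltn_neqAle; apply/andP; split.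
  by apply/eqP => /val_inj/(rotate_inj l_inj) e; rewrite e anc_irr in vw.
rewrite sub_next; apply: next_enum_max => // z /cycle_setP[_ _ [u hu <-]].
case/orP: hu => [/eqP->//|vu].
by apply: ltnW; have := h u; rewrite vu.
Qed.

(** With the maximum at [v], only [v] wraps around. Below it, labels outside the cycle set are fixed
    and smaller than all those inside, which move up one place. *)
Lemma rotate_ltn l v : injective l -> max_at l v -> marked l v ->
  {in anc v &, forall w w', (rotate l v w < rotate l v w') = (l w < l w')}.
Proof.
move=> l_inj + mv; rewrite /max_at mv => /forallP lmax.
have mono w w' : anc v w -> anc v w' -> l w < l w' ->
    rotate l v w < rotate l v w'.
  move=> vw vw' lt.
  have [exw'|nexw'] := boolP (exceeds l v (l w')); last first.
    have nexw : ~~ exceeds l v (l w).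
      by apply: contra nexw'; apply: exceeds_leq (ltnW lt).
    by rewrite !rotate_id // mem_cycle_set // negb_and ?nexw ?nexw'.
  have [exw|nexw] := boolP (exceeds l v (l w)); last first.
    rewrite (rotate_id (w := w)) ?mem_cycle_set // ?negb_and ?nexw //.
    by apply: exceeds_ltn nexw; rewrite exceeds_rotate_label // vw' orbT.
  have wB : l w \in cycle_set l v by rewrite mem_cycle_set // exw vw orbT.
  have w'B : l w' \in cycle_set l v by rewrite mem_cycle_set // exw' vw' orbT.
  have vB : l v \in cycle_set l v by rewrite mem_cycle_set ?eqxx ?andbT.
  have [_ le1] := next_enum_ltn wB w'B lt.
  have [lt2 _] := next_enum_ltn w'B vB (implyP (lmax w') vw').
  by rewrite !ffunE; apply: leq_ltn_trans lt2.
move=> w w' vw vw'.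
case: (ltngtP (l w) (l w')) => [lt|lt|/val_inj/l_inj->]; last by rewrite ltnn.
  exact: mono.
by apply/negbTE; rewrite -leqNgt ltnW // mono.
Qed.

Hypothesis anc_chain :
  forall u v w, anc u w -> anc v w -> [|| u == v, anc u v | anc v u].

Lemma exceeds_desc_rotate l v u w : injective l -> marked l v -> anc v u ->
    anc v w -> exceeds l u (rotate l v w) = exceeds l u (l w).
Proof.
move=> l_inj mv vu vw.
have [wB|wB] := boolP (l w \in cycle_set l v); last by rewrite rotate_id.
have: rotate l v w \in cycle_set l v by rewrite mem_rotate.
case/cycle_setP: wB => _ ex1 _ /cycle_setP[_ ex2 _].
by rewrite !(exceeds_anc vu).
Qed.

(** Ancestors form a chain, so the subtree of [u] contains that of [v] or misses it. Either way the
    set of labels strictly below [u] is preserved. *)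
Lemma forall_desc_rotate l v u (Q : pred 'I_n) : injective l ->
    u != v -> ~~ anc v u ->
  [forall w, anc u w ==> Q (rotate l v w)] = [forall w, anc u w ==> Q (l w)].
Proof.
move=> l_inj uv nvu.
have desc w w' : l w \in cycle_set l v -> anc u w -> (w' == v) || anc v w' ->
    anc u w'.
  move=> wB uw hw'; have /cycle_setP[mv _ _] := wB.
  have au : anc u v.
    move: wB; rewrite mem_cycle_set // => /andP[_ /orP[/eqP<-//|vw]].
    by have := anc_chain uw vw; rewrite (negbTE uv) (negbTE nvu) orbF.
  by case/orP: hw' => [/eqP->//|]; apply: anc_trans au.
apply/forallP/forallP => h w; apply/implyP => uw;
    have [wB|wB] := boolP (l w \in cycle_set l v).
- have [w' hw' <-] := rotate_onto wB.
  exact: (implyP (h w') (desc _ _ wB uw hw')).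
- by rewrite -(rotate_id wB); apply: (implyP (h w) uw).
- have: rotate l v w \in cycle_set l v by rewrite mem_rotate.
  case/cycle_setP=> _ _ [w' hw' <-].
  exact: (implyP (h w') (desc _ _ wB uw hw')).
- by rewrite rotate_id //; apply: (implyP (h w) uw).
Qed.

(** If [v] is unmarked, nothing moves. If [u] lies below [v], the order of labels and whether [u]
    exceeds at them are kept throughout its subtree. Otherwise [u] keeps its label and its
    descendants keep their set of labels. *)
Lemma max_min_at_rotate l v u : injective l -> max_at l v -> u != v ->
  max_at (rotate l v) u = max_at l u /\ min_at (rotate l v) u = min_at l u.
Proof.
move=> l_inj lmax uv; rewrite /max_at /min_at /marked exceeds_rotate //.
have e1 : [forall w, anc u w && exceeds (rotate l v) u (rotate l v w)
                     ==> (rotate l v u < rotate l v w)] =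
          [forall w, anc u w && exceeds l u (rotate l v w)
                     ==> (rotate l v u < rotate l v w)].
  by apply: eq_forallb => w; rewrite exceeds_rotate.
rewrite {}e1.
have [mv|nmv] := boolP (marked l v); last first.
  have e w : rotate l v w = l w.
    by apply: rotate_id; apply: contra nmv => /cycle_setP[].
  by split; rewrite e; congr (_ ==> _); apply: eq_forallb => w; rewrite e.
have [vu|nvu] := boolP (anc v u).
  rewrite exceeds_desc_rotate //; split; congr (_ ==> _);
    apply: eq_forallb => w.
    have [uw|//] := boolP (anc u w).
    by rewrite rotate_ltn // /in_mem /= ?(anc_trans vu uw).
  have [uw|//] := boolP (anc u w).
  have vw := anc_trans vu uw.
  by rewrite exceeds_desc_rotate // rotate_ltn.
have -> : rotate l v u = l u.
  by apply: rotate_id; rewrite mem_cycle_set // (negbTE uv) (negbTE nvu) andbF.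
split; congr (_ ==> _).
  exact: (@forall_desc_rotate l v u (fun y => y < l u)).
(* Currying leaves a predicate of the label of [w] alone, as [forall_desc_rotate] requires. *)
have curry (f : V -> 'I_n) :
    [forall w, anc u w && exceeds l u (f w) ==> (l u < f w)] =
    [forall w, anc u w ==> (exceeds l u (f w) ==> (l u < f w))].
  by apply: eq_forallb => w; case: (anc u w).
rewrite !curry.
exact: (@forall_desc_rotate l v u (fun y => exceeds l u y ==> (l u < y))).
Qed.

End Thresholds.

(** * Exchanging the two conditions vertex by vertex *)

Section CountLabelings.

Variables (V : finType) (n m : nat) (anc : rel V) (rho : 'I_m -> nat).
Hypotheses (anc_trans : transitive anc) (anc_irr : irreflexive anc).
Hypothesis anc_chain :
  forall u v w, anc u w -> anc v w -> [|| u == v, anc u v | anc v u].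

Lemma label_inj (l : labeling V n) : injective (label l).
Proof. by case: l => l /= /asboolP/bij_inj. Qed.

Lemma rotate_bij (l : labeling V n) v :
  `[< bijective (rotate anc rho (label l) v) >].
Proof.
apply/asboolP; apply: inj_card_bij; first exact/rotate_inj/label_inj.
by case: l => l /= /asboolP/bij_eq_card ->.
Qed.

Definition rotate_labeling v (l : labeling V n) : labeling V n :=
  Labeling (rotate_bij l v).

Lemma rotate_labeling_inj v : injective (rotate_labeling v).
Proof.
move=> l l' /(congr1 (@label V n)) /= e; apply/val_inj/ffunP.
by apply: rotate_can_inj e => //; apply: label_inj.
Qed.

(** Interpolates between the maximum condition everywhere, for empty [S], and the minimum condition
    everywhere, for [S] listing all vertices. *)
Definition hybrid (S : seq V) (l : V -> 'I_n) : bool :=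
  [forall v, if v \in S then min_at anc rho l v else max_at anc rho l v].

(** If the maximum condition fails at [v], both sides are false by [min_at_rotate]; if it holds,
    [max_min_at_rotate] preserves the conditions elsewhere. *)
Lemma hybrid_rotate v S (l : labeling V n) : v \notin S ->
  hybrid (v :: S) (label (rotate_labeling v l)) = hybrid S (label l).
Proof.
move=> vS; have l_inj := @label_inj l.
have [lmax|nlmax] := boolP (max_at anc rho (label l) v); last first.
  have -> : hybrid S (label l) = false.
    by apply/negbTE/forallPn; exists v; rewrite (negbTE vS).
  apply/negbTE/forallPn; exists v.
  by rewrite mem_head min_at_rotate.
apply: eq_forallb => u; rewrite inE.
have [->|uv] := eqVneq u v; first by rewrite /= (negbTE vS) min_at_rotate.
by have [-> ->] := max_min_at_rotate anc_trans anc_chain l_inj lmax uv.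
Qed.

Lemma card_hybrid S : uniq S ->
  #|[set l : labeling V n | hybrid S (label l)]| =
  #|[set l : labeling V n | hybrid [::] (label l)]|.
Proof.
elim: S => //= v S IH /andP[vS /IH <-].
(* An injective self-map of a finite type is bijective, so preimages keep their cardinality. *)
rewrite -(card_preimset _ (@rotate_labeling_inj v)); apply: eq_card => l.
by rewrite !inE hybrid_rotate.
Qed.

Lemma card_min_at_max_at :
  #|[set l : labeling V n | [forall v, min_at anc rho (label l) v]]| =
  #|[set l : labeling V n | [forall v, max_at anc rho (label l) v]]|.
Proof.
rewrite -[RHS](eq_card (A := [set l | hybrid [::] (label l)])); last first.
  by move=> l; rewrite !inE.
rewrite -(card_hybrid (enum_uniq V)); apply: eq_card => l; rewrite !inE.
by apply: eq_forallb => v; rewrite mem_enum.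
Qed.

End CountLabelings.

(** * Ancestry in a forest *)

Section ForestOrder.

Variables (V : finType) (p : {ffun V -> option V}).

Lemma connect_parent u v :
  connect (is_parent p) v u = (u == v) || strict_anc p u v.
Proof.
apply/idP/orP.
  case/connectP=> -[/= _ ->|w q /= /andP[vw wq] ->]; first by left.
  by right; apply/existsP; exists w; rewrite vw; apply/connectP; exists q.
case=> [/eqP->|/existsP[w /andP[vw wu]]]; first exact: connect0.
exact: connect_trans (connect1 vw) wu.
Qed.

Lemma strict_anc_trans : transitive (strict_anc p).
Proof.
move=> v u w uv /existsP[x /andP[wx xv]]; apply/existsP; exists x.
rewrite wx; apply: connect_trans xv _.
by rewrite connect_parent uv orbT.
Qed.

(** A vertex has at most one parent, so two parent paths from [x] agree until one of them ends. *)
Lemma connect_parent_chain x y z :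
    connect (is_parent p) x y -> connect (is_parent p) x z ->
  connect (is_parent p) y z || connect (is_parent p) z y.
Proof.
case/connectP=> q; elim: q x => [x _ /= -> -> //|w q IH x].
move=> /= /andP[xw wq] ylast.
rewrite [connect _ x z]connect_parent => /orP[/eqP->|].
  apply/orP; right; apply/connectP; exists (w :: q) => //=.
  by rewrite xw.
case/existsP=> w' /andP[xw' w'z]; apply: IH wq ylast _.
by move: xw xw'; rewrite /is_parent => /eqP-> /eqP[->].
Qed.

Lemma strict_anc_chain u v w : strict_anc p u w -> strict_anc p v w ->
  [|| u == v, strict_anc p u v | strict_anc p v u].
Proof.
move=> /existsP[x /andP[/eqP wx xu]] /existsP[y /andP[/eqP]].
rewrite wx => -[<-] xv.
have := connect_parent_chain xu xv; rewrite !connect_parent [v == u]eq_sym.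
by case: (u == v) => //=; rewrite orbC.
Qed.

End ForestOrder.

Lemma strict_anc_irr (V : finType) (F : forest V) :
  irreflexive (strict_anc (parent F)).
Proof. by case: F => p /= /forallP h v; apply/negbTE/h. Qed.

(** * Avoidance as a condition at marked vertices *)

Section Patterns.

Variables (V : finType) (n m : nat) (F : forest V).
Variables (l : V -> 'I_n) (s : 'S_m.+2) (rho : 'I_m -> nat).
Local Notation anc := (strict_anc (parent F)).

Definition early (j : 'I_m) : 'I_m.+2 :=
  widen_ord (leqnSn m.+1) (widen_ord (leqnSn m) j).
Definition penult : 'I_m.+2 := widen_ord (leqnSn m.+1) ord_max.

Lemma ord_early_cases (i : 'I_m.+2) :
  [\/ exists j, i = early j, i = penult | i = ord_max].
Proof.
have [im|im] := ltnP i m.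
  by constructor 1; exists (Ordinal im); apply: val_inj.
have [/eqP e|ne] := boolP (i == m :> nat).
  by constructor 2; apply: val_inj.
constructor 3; apply: val_inj => /=; apply/eqP; rewrite eqn_leq.
by rewrite -ltnS ltn_ord /= ltn_neqAle eq_sym ne im.
Qed.

Hypothesis l_inj : injective l.
Hypothesis s_early : forall j, s (early j) = rho j :> nat.
Hypothesis s_penult : forall j, rho j < s penult.
Hypothesis s_last : forall j, rho j < s ord_max.

(** The last two entries of [s] exceed all earlier ones, so only their mutual order distinguishes
    the two patterns; one decomposition serves both. *)
Lemma has_instanceP :
  (exists v : {ffun 'I_m.+2 -> V}, is_instance F l s v) <->
  exists r a b, [/\ is_occurrence anc rho l r,
    forall i, [/\ anc (r i) a, l (r i) < l a & l (r i) < l b],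
    anc a b & (l a < l b) = (s penult < s ord_max)].
Proof.
split=> [[v /forallP h]|[r [a [b [/forallP occ below ab lab]]]]].
  have hanc (i j : 'I_m.+2) : i < j -> anc (v i) (v j).
    by move=> ij; have /forallP/(_ j)/andP[/implyP/(_ ij)] := h i.
  have hlt i j : (l (v i) < l (v j)) = (s i < s j).
    by have /forallP/(_ j)/andP[_ /eqP] := h i.
  exists [ffun j => v (early j)], (v penult), (v ord_max); split.
  - apply/forallP => i; apply/forallP => j; rewrite !ffunE hlt !s_early eqxx.
    by rewrite andbT; apply/implyP => ij; apply: hanc.
  - move=> i; rewrite ffunE !hlt s_early s_penult s_last; split=> //.
    by apply: hanc => /=.
  - exact: hanc.
  - exact: hlt.
pose v : {ffun 'I_m.+2 -> V} := [ffun i => if insub (val i) is Some j then r j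
                               else if i == penult then a else b].
have ve j : v (early j) = r j.
  by rewrite ffunE (_ : val (early j) = val j) // valK.
have vp : v penult = a by rewrite ffunE insubF ?eqxx //= ltnn.
have vl : v ord_max = b.
  rewrite ffunE insubF ?ltnNge ?leqnSn //=.
  by rewrite -val_eqE /= gtn_eqF.
exists v; apply/forallP => i; apply/forallP => j.
(* [lab] compares [a] with [b] one way only; the reverse comparison follows because the two labels
   differ, as do the two values of [s]. *)
have nba : (l b < l a) = (s ord_max < s penult).
  have swap (x y : nat) : x != y -> (y < x) = ~~ (x < y).
    by case: (ltngtP x y).
  rewrite (swap (l a)) ?(swap (s penult)) ?lab //.
    apply/eqP => /val_inj/perm_inj/(congr1 val)/eqP /=.
    by rewrite ltn_eqF.
  by apply/eqP => /val_inj/l_inj e; rewrite e strict_anc_irr in ab.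
case: (ord_early_cases i) => [[i' ->]|->|->];
  case: (ord_early_cases j) => [[j' ->]|->|->];
  rewrite ?ve ?vp ?vl ?s_early ?ltnn //=.
- by have /forallP/(_ j') := occ i'.
- by have [-> -> _] := below i'; rewrite s_penult implybT.
- have [ia _ ->] := below i'.
  by rewrite (strict_anc_trans ia ab) s_last implybT.
- have [_ lt _] := below j'.
  rewrite [m < _]ltnNge [j' <= m]ltnW // [l a < _]ltnNge (ltnW lt).
  by rewrite [s _ < _]ltnNge ltnW ?s_penult.
- by rewrite ltnSn ab lab eqxx.
- have [_ _ lt] := below j'.
  rewrite [m.+1 < _]ltnNge (leq_trans (ltnW (ltn_ord j'))) //.
  by rewrite [l b < _]ltnNge (ltnW lt) [s _ < _]ltnNge ltnW ?s_last.
- by rewrite ltnNge leqnSn nba eqxx.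
Qed.

(** An instance is a marked [a] with a descendant [b] of larger label: an occurrence of [rho] below
    the label of [a] is also below that of [b]. *)
Lemma avoids_max_at : s penult < s ord_max ->
  avoids F l s = [forall v, max_at anc rho l v].
Proof.
move=> s_lt; apply/existsPn/forallP => [noinst a|hmax v].
  apply/implyP => /existsP[r /andP[occ /forallP below]].
  apply/forallP => b; apply/implyP => ab; rewrite ltnNge leq_eqVlt.
  apply/negP => /orP[/eqP/val_inj/l_inj e|lab].
    by rewrite e strict_anc_irr in ab.
  have [|v vi] := has_instanceP.2; last by have := noinst v; rewrite vi.
  exists r, a, b; split; rewrite ?s_lt // => i.
  have /andP[ia lt] := below i; split=> //.
  exact: ltn_trans lab.
apply/negP => vi; have [|r [a [b [occ below ab]]]] := has_instanceP.1.
  by exists v.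
have am : marked anc rho l a.
  apply/existsP; exists r; rewrite occ; apply/forallP => i.
  by have [-> ->] := below i.
rewrite s_lt => lab; have := hmax a; rewrite /max_at am => /forallP/(_ b).
by rewrite ab /= ltnNge (ltnW lab).
Qed.

(** Now [b] has the smaller label, so the occurrence of [rho] must lie below [l b]: [a] exceeds at
    that height, and is marked since [l b < l a]. *)
Lemma avoids_min_at : s ord_max < s penult ->
  avoids F l s = [forall v, min_at anc rho l v].
Proof.
move=> s_lt; apply/existsPn/forallP => [noinst a|hmin v].
  apply/implyP => /existsP[r0 /andP[_ _]].
  apply/forallP => b; apply/implyP.
  case/andP=> ab /existsP[r /andP[occ /forallP below]].
  rewrite ltnNge leq_eqVlt; apply/negP => /orP[/eqP/val_inj/l_inj e|lab].
    by rewrite e strict_anc_irr in ab.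
  have [|v vi] := has_instanceP.2; last by have := noinst v; rewrite vi.
  exists r, a, b; split=> //; last by rewrite !leq_gtF // ltnW.
  move=> i; have /andP[ia lt] := below i; split=> //.
  exact: ltn_trans lab.
apply/negP => vi; have [|r [a [b [occ below ab]]]] := has_instanceP.1.
  by exists v.
rewrite (leq_gtF (ltnW s_lt)) => /negbT; rewrite -leqNgt => lab.
have am : marked anc rho l a.
  apply/existsP; exists r; rewrite occ; apply/forallP => i.
  by have [-> ->] := below i.
have := hmin a; rewrite /min_at am => /forallP/(_ b).
rewrite ab (leq_gtF lab) implybF => /existsPn/(_ r).
rewrite occ => /forallPn[i].
by have [-> _ ->] := below i.
Qed.

End Patterns.

(** * Relabeling vertices, and passage to forests on [n] *)

Lemma strict_anc_homo (V W : finType) (p : {ffun V -> option V})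
    (q : {ffun W -> option W}) (f : V -> W) :
    {homo f : v u / is_parent p v u >-> is_parent q v u} ->
  {homo f : u v / strict_anc p u v >-> strict_anc q u v}.
Proof.
move=> fpq u v /existsP[w /andP[vw /connectP[s ws ->]]].
apply/existsP; exists (f w); rewrite fpq //=; apply/connectP.
by exists (map f s); [exact: homo_path ws | rewrite last_map].
Qed.

Section Relabel.

Variables (V W : finType) (f : V -> W) (g : W -> V).
Hypotheses (fK : cancel f g) (gK : cancel g f).

Definition relabel_parent (p : {ffun V -> option V}) : {ffun W -> option W} :=
  [ffun w => omap f (p (g w))].

Lemma strict_anc_relabel p u v :
  strict_anc (relabel_parent p) (f u) (f v) = strict_anc p u v.
Proof.
apply/idP/idP; last first.
  by apply: strict_anc_homo => x y /eqP e; rewrite /is_parent ffunE fK e.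
rewrite -{2}(fK u) -{2}(fK v); apply: strict_anc_homo => x y.
rewrite /is_parent ffunE; case: (p (g x)) => //= z /eqP[<-].
by rewrite fK.
Qed.

Lemma relabel_acyclic (F : forest V) : acyclic (relabel_parent (parent F)).
Proof.
by apply/forallP => w; rewrite -(gK w) strict_anc_relabel strict_anc_irr.
Qed.

Definition relabel (F : forest V) : forest W := Forest (relabel_acyclic F).

Lemma relabel_inj : injective relabel.
Proof.
move=> F G /(congr1 (@parent W)) /= /ffunP e; apply/val_inj/ffunP => v /=.
have := e (f v); rewrite !ffunE fK; exact: (inj_omap (can_inj fK)).
Qed.

Lemma avoids_relabel n (F : forest V) (l : W -> 'I_n) k (s : 'S_k) :
  avoids (relabel F) l s = avoids F (l \o f) s.
Proof.
congr (~~ _); apply/existsP/existsP => -[v /forallP h].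
  exists [ffun i => g (v i)]; apply/forallP => i; apply/forallP => j.
  have /forallP/(_ j) := h i.
  by rewrite !ffunE /= !gK -strict_anc_relabel !gK.
exists [ffun i => f (v i)]; apply/forallP => i; apply/forallP => j.
by have /forallP/(_ j) := h i; rewrite !ffunE /= strict_anc_relabel.
Qed.

End Relabel.

(** Renaming each vertex by its label under [l] permutes the forests on [n] and makes the vertices
    their own labels. *)
Lemma card_avoiding_forests n S (l : labeling 'I_n n) :
  #|[pred F : forest 'I_n | `[< avoids_set F (label l) S >]]| = num_forests n S.
Proof.
have /asboolP[g fK gK] : `[< bijective (label l) >] by case: l.
rewrite /num_forests -[LHS]cardsE -[RHS]cardsE.
rewrite -[RHS](card_preimset _ (@relabel_inj _ _ _ _ fK gK)).
apply: eq_card => F; rewrite !inE; congr (`[< _ >]); apply: eq_forall => s.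
by rewrite avoids_relabel.
Qed.

(** Double counting of the pairs of a forest on [n] and an avoiding labeling of it: each labeling
    contributes [num_forests n S]. *)
Lemma sum_num_labelings n S :
  \sum_(F : forest 'I_n) num_labelings n F S =
  #|{: labeling 'I_n n}| * num_forests n S.
Proof.
under eq_bigr do rewrite /num_labelings -sum1_card big_mkcond.
rewrite exchange_big /= -sum_nat_const; apply: eq_bigr => l _.
by rewrite -big_mkcond sum1_card card_avoiding_forests.
Qed.

Lemma forest_structure_Wilf_equivW S S' :
  forest_structure_Wilf_equiv S S' -> forest_Wilf_equiv S S'.
Proof.
move=> eqS n; have idb : `[< bijective [ffun i : 'I_n => i] >].
  by apply/asboolP; exists id => i; rewrite ffunE.
(* The identity is a labeling, so the common factor can be cancelled. *)
have lab_gt0 : 0 < #|{: labeling 'I_n n}|.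
  by apply/card_gt0P; exists (Labeling idb).
apply/eqP; rewrite -(eqn_pmul2l lab_gt0) -!sum_num_labelings; apply/eqP.
by apply: eq_bigr => F _; apply: eqS; rewrite card_ord.
Qed.

(** * The equivalence of the two patterns *)

Lemma avoids_set1 (V : finType) n (F : forest V) (l : V -> 'I_n) k (s : 'S_k) :
  `[< avoids_set F l [set to_pattern s]%classic >] = avoids F l s.
Proof.
by apply/asboolP/idP => [/(_ (to_pattern s)) -> //|h _ ->].
Qed.

Lemma eq_card_bijective (T T' : finType) :
  #|T| = #|T'| -> exists f : T -> T', bijective f.
Proof.
move=> e; exists (fun x => enum_val (cast_ord e (enum_rank x))).
exists (fun y => enum_val (cast_ord (esym e) (enum_rank y))) => x.
  by rewrite enum_valK cast_ordK enum_rankK.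
by rewrite enum_valK cast_ordKV enum_rankK.
Qed.

Theorem theorem1p2 (k : nat) (hk : 3 <= k) (tau tau' : 'S_k)
    (htau1 : forall i : 'I_k, i = k - 2 :> nat -> tau i = k - 2 :> nat)
    (htau2 : forall i : 'I_k, i = k - 1 :> nat -> tau i = k - 1 :> nat)
    (htau'0 : forall i : 'I_k, i < k - 2 -> tau' i = tau i)
    (htau'1 : forall i : 'I_k, i = k - 2 :> nat -> tau' i = k - 1 :> nat)
    (htau'2 : forall i : 'I_k, i = k - 1 :> nat -> tau' i = k - 2 :> nat) :
  [/\ forall (V : finType) (n : nat) (F : forest V), #|V| = n ->
        exists phi : {l : labeling V n | avoids F (label l) tau} ->
                     {l : labeling V n | avoids F (label l) tau'},
          bijective phi,
      forest_structure_Wilf_equiv [set to_pattern tau]%classic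
                                  [set to_pattern tau']%classic
    & forest_Wilf_equiv [set to_pattern tau]%classic
                        [set to_pattern tau']%classic].
Proof.
(* All three claims follow from equal counts on a fixed forest. *)
have card_avoids (V : finType) n (F : forest V) :
    #|[pred l : labeling V n | avoids F (label l) tau]| =
    #|[pred l : labeling V n | avoids F (label l) tau']|.
  case: k hk tau tau' htau1 htau2 htau'0 htau'1 htau'2 => [|[|m]] // _.
  rewrite subSS subn1 !subSS subn0 /= => tau tau' ht1 ht2 ht'0 ht'1 ht'2.
  pose rho j : nat := tau (early j).
  (* [tau] is injective and takes the values [m] and [m.+1] at the last two positions. *)
  have rho_lt j : rho j < m.
    have : rho j != m.
      apply/eqP; rewrite -(ht1 (penult m)) // => /val_inj/perm_inj/(congr1 val).
      by move=> /= e; have := ltn_ord j; rewrite e ltnn.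
    have : rho j != m.+1.
      apply/eqP; rewrite -(ht2 ord_max) // => /val_inj/perm_inj/(congr1 val).
      by move=> /= e; have := leqW (ltn_ord j); rewrite e ltnn.
    have := ltn_ord (tau (early j)); rewrite -/(rho j) !ltnS leq_eqVlt.
    by move=> /orP[/eqP->|]; rewrite ?eqxx // ltnS leq_eqVlt => /orP[/eqP->|];
       rewrite ?eqxx.
  have tau_p : tau (penult m) = m :> nat by apply: ht1.
  have tau_l : tau ord_max = m.+1 :> nat by apply: ht2.
  have tau'_p : tau' (penult m) = m.+1 :> nat by apply: ht'1.
  have tau'_l : tau' ord_max = m :> nat by apply: ht'2.
  have tau'_e j : tau' (early j) = rho j :> nat by rewrite ht'0 //= ltn_ord.
  have card_eq := card_min_at_max_at n rho (@strict_anc_trans _ (parent F))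
    (@strict_anc_irr _ F) (@strict_anc_chain _ (parent F)).
  apply: etrans (etrans _ (esym card_eq)) _; apply: eq_card => l; rewrite !inE.
    apply: avoids_max_at => [|//|j|j|]; first exact: label_inj.
    - by rewrite tau_p.
    - by rewrite tau_l ltnS ltnW.
    - by rewrite tau_p tau_l.
  apply/esym/avoids_min_at => [|//|j|j|]; first exact: label_inj.
  - by rewrite tau'_p ltnS ltnW.
  - by rewrite tau'_l.
  - by rewrite tau'_p tau'_l.
have struct : forest_structure_Wilf_equiv [set to_pattern tau]%classic
                                  [set to_pattern tau']%classic.
  move=> V n F _; apply: etrans (etrans (card_avoids V n F) _);
    by apply: eq_card => l; rewrite !inE avoids_set1.
split=> //; last exact: forest_structure_Wilf_equivW.
by move=> V n F _; apply: eq_card_bijective; rewrite !card_sig card_avoids.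
Qed.
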